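(* Let $A\in SM_d(\mathbb{R})^g$ and let $W\in M_{g+1}(\mathbb{R})$ be a matrix such that $\mathcal{P}_W$ is an invertible projective transformation of $\mathcal{D}_A$. Assume that both $\mathcal{D}_A$ and $\mathcal{P}_W(\mathcal{D}_A)$ are bounded free spectrahedra. Then for any $X\in\mathcal{D}_A$ one has $X\in\partial^{\mathrm{Arv}}\mathcal{D}_A$ if and only if $\mathcal{P}_W(X)\in\partial^{\mathrm{Arv}}(\mathcal{P}_W(\mathcal{D}_A))$. Equivalently, one has $$\partial^{\mathrm{Arv}}(\mathcal{P}_W(\mathcal{D}_A))=\mathcal{P}_W(\partial^{\mathrm{Arv}}\mathcal{D}_A).$$
   Context: $SM_n(\mathbb{R})^g$ is the set of $g$-tuples of real symmetric $n\times n$ matrices, $SM(\mathbb{R})^g=\bigcup_nSM_n(\mathbb{R})^g$. Products $VXW$ and direct sums of tuples are coordinatewise. For $A\in SM_d(\mathbb{R})^g$, $L_A(X)=I_{dn}+\sum_{i=1}^gA_i\otimes X_i$ for $X\in SM_n(\mathbb{R})^g$, and the free spectrahedron is $\mathcal{D}_A=\{X\in SM(\mathbb{R})^g:L_A(X)\succeq0\}$; it is bounded if there is $C>0$ with $C\,I-\sum_iX_i^2\succeq0$ for all $X\in\mathcal{D}_A$. If $U^TAU=A^1\oplus A^2$ with $U$ orthogonal, then $L_{A^1},L_{A^2}$ are subpencils of $L_A$; $A$ is a minimal defining tuple for $\mathcal{D}_A$ if no proper subpencil $L_{A^i}$ satisfies $\mathcal{D}_{A^i}=\mathcal{D}_A$.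 For $(A_0,A)\in SM_d(\mathbb{R})^{g+1}$ the homogeneous free spectrahedron is $\mathcal{H}_{(A_0,A)}=\{(X_0,X)\in SM(\mathbb{R})^{g+1}:\sum_{i=0}^gA_i\otimes X_i\succeq0\}$. It is positive if $(1,0,\dots,0)\in\mathbb{R}^{g+1}$ is in the interior of its set of elements of size $1$. The homogenization of $\mathcal{D}_A$ is $\mathfrak{H}(\mathcal{D}_A)=\mathcal{H}_{(I,\check A)}$, where $\check A$ is any minimal defining tuple for $\mathcal{D}_A$ (this is independent of the choice). For a homogeneous free spectrahedron $\mathcal{H}$, $\mathfrak{H}^{-1}(\mathcal{H})=\{X\in SM(\mathbb{R})^g:(I,X)\in\mathcal{H}\}$. For $W\in M_{g+1}(\mathbb{R})$, $\mathcal{T}_W$ is the map on $(g+1)$-tuples $Z$ of matrices given by $\mathcal{T}_WZ=(\sum_jW_{1j}Z_j,\dots,\sum_jW_{(g+1)j}Z_j)$ where the coordinates of $Z$ are listed in order. $\mathcal{P}_W$ is a projective transformation of $\mathcal{D}_A$ if $\mathcal{T}_W(\mathfrak{H}(\mathcal{D}_A))$ is a positive homogeneous free spectrahedron, and it is invertible if and only if $W$ is an invertible matrix. In that case $\mathcal{P}_W(\mathcal{D}_A)=\mathfrak{H}^{-1}(\mathcal{T}_W(\mathfrak{H}(\mathcal{D}_A)))$, and for $X\in\mathcal{D}_A$, $\mathcal{P}_W(X)=\mathfrak{H}^{-1}(\mathcal{T}_W(\mathfrak{H}(X)))$, where $\mathfrak{H}(X)=(I,X)$ and, for a tuple $(X_0,X)$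 with $X_0\succeq0$, $\mathfrak{H}^{-1}(X_0,X)=X_0^{\dagger/2}XX_0^{\dagger/2}$, with $X_0^{\dagger/2}$ the positive semidefinite square root of the Moore-Penrose pseudoinverse of $X_0$. (When $\mathcal{P}_W(\mathcal{D}_A)$ is bounded, the first component of $\mathcal{T}_W(I,X)$ is positive semidefinite for every $X\in\mathcal{D}_A$, so $\mathcal{P}_W(X)$ is well defined.) An element $X$ of size $n$ of a free spectrahedron $\mathcal{D}$ is in the Arveson boundary $\partial^{\mathrm{Arv}}\mathcal{D}$ if $\begin{pmatrix}X&\beta\\\beta^T&\gamma\end{pmatrix}\in\mathcal{D}$ (with $\beta\in M_{n\times m}(\mathbb{R})^g$, $\gamma\in SM_m(\mathbb{R})^g$, $m\ge1$) implies $\beta=0$. *)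

(* Defs.v *)
From HB Require Import structures.
From mathcomp Require Import all_boot all_order all_algebra.
From mathcomp Require Import all_classical all_reals all_analysis.
From mathcomp Require Export mxtens.

Import Order.TTheory GRing.Theory Num.Theory.
Import numFieldNormedType.Exports.

Local Open Scope classical_set_scope.
Local Open Scope ring_scope.

Section FreeSpectrahedra.
Context {R : realType}.

Definition psd {n} (M : 'M[R]_n) : Prop :=
  M^T = M /\ forall v : 'cV[R]_n, 0 <= (v^T *m M *m v) 0 0.

(* A tuple over 'I_g.+1 is read (X_0, X_1, ..., X_g). *)
Definition mxtuple (g n : nat) : Type := 'I_g -> 'M[R]_n.

(* Matrix sizes are positive: membership in SM excludes n = 0, so every
   free set, defining tuple and diagonal block below has positive size. *)
Definition SM {g n} (X : mxtuple g n) : Prop :=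
  (0 < n)%N /\ forall i, (X i)^T = X i.

Definition free_set (g : nat) : Type := forall n : nat, set (mxtuple g n).

Definition Lpencil {g d n} (A : mxtuple g d) (X : mxtuple g n) : 'M[R]_(d * n) :=
  1%:M + \sum_i A i *t X i.

Definition free_spectrahedron {g d} (A : mxtuple g d) : free_set g :=
  fun n => [set X | SM X /\ psd (Lpencil A X)].

Definition hom_free_spectrahedron {g d} (A : mxtuple g.+1 d) : free_set g.+1 :=
  fun n => [set X | SM X /\ psd (\sum_i A i *t X i)].

Definition bounded_free_set {g} (D : free_set g) : Prop :=
  exists C : R, 0 < C /\
    forall n (X : mxtuple g n), D n X -> psd (C%:M - \sum_i X i *m X i).

Definition bounded_free_spectrahedron {g} (D : free_set g) : Prop :=
  (exists d (A : mxtuple g d), SM A /\ D = free_spectrahedron A) /\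
  bounded_free_set D.

(* The equations on U force d = d1 + d2. *)
Definition orthogonal_splitting {g d d1 d2} (A : mxtuple g d)
    (U : 'M[R]_(d, d1 + d2)) (A1 : mxtuple g d1) (A2 : mxtuple g d2) : Prop :=
  [/\ U^T *m U = 1%:M, U *m U^T = 1%:M, SM A1, SM A2
    & forall i, U^T *m A i *m U = block_mx (A1 i) 0 0 (A2 i)].

Definition minimal_defining_tuple {g d} (A : mxtuple g d) (D : free_set g) :
    Prop :=
  [/\ SM A, free_spectrahedron A = D
    & forall d1 d2 (U : 'M[R]_(d, d1 + d2))
        (A1 : mxtuple g d1) (A2 : mxtuple g d2),
      orthogonal_splitting A U A1 A2 ->
      free_spectrahedron A1 <> D /\ free_spectrahedron A2 <> D].

Definition homogenize {g n} (X : mxtuple g n) : mxtuple g.+1 n :=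
  fun i => if unlift ord0 i is Some j then X j else 1%:M.

(* H is the homogenization of D computed from some minimal defining tuple. *)
Definition is_homogenization {g} (D : free_set g) (H : free_set g.+1) : Prop :=
  exists d (A : mxtuple g d),
    minimal_defining_tuple A D /\ H = hom_free_spectrahedron (homogenize A).

Definition dehomogenize_set {g} (H : free_set g.+1) : free_set g :=
  fun n => [set X | SM X /\ H n (homogenize X)].

Definition level1 {g} (H : free_set g) : set 'rV[R]_g :=
  [set x | H 1%N (fun i => (x 0 i)%:M)].

Definition positive_hom_free_spectrahedron {g} (H : free_set g.+1) : Prop :=
  (exists d (B : mxtuple g.+1 d), SM B /\ H = hom_free_spectrahedron B) /\
  (interior (level1 H)) (delta_mx 0 ord0).

Definition Tmap {g n} (W : 'M[R]_g) (Z : mxtuple g n) : mxtuple g n :=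
  fun i => \sum_j W i j *: Z j.

Definition Timage {g} (W : 'M[R]_g) (H : free_set g) : free_set g :=
  fun n => Tmap W @` H n.

Definition is_moore_penrose {n} (M P : 'M[R]_n) : Prop :=
  [/\ M *m P *m M = M, P *m M *m P = P,
      (M *m P)^T = M *m P & (P *m M)^T = P *m M].

Definition moore_penrose {n} (M : 'M[R]_n) : 'M[R]_n :=
  xget 0 [set P | is_moore_penrose M P].

(* Meaningful for psd M only, which has exactly one psd square root. *)
Definition psd_sqrt {n} (M : 'M[R]_n) : 'M[R]_n :=
  xget 0 [set S | psd S /\ S *m S = M].

Definition dehomogenize {g n} (Z : mxtuple g.+1 n) : mxtuple g n :=
  let S := psd_sqrt (moore_penrose (Z ord0)) in
  fun j => S *m Z (lift ord0 j) *m S.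

Definition Pmap {g n} (W : 'M[R]_g.+1) (X : mxtuple g n) : mxtuple g n :=
  dehomogenize (Tmap W (homogenize X)).

(* In the next two definitions, H stands for the homogenization of the free
   spectrahedron being transformed. *)
Definition projective_transformation {g} (W : 'M[R]_g.+1) (H : free_set g.+1) :
    Prop :=
  positive_hom_free_spectrahedron (Timage W H).

Definition projective_image {g} (W : 'M[R]_g.+1) (H : free_set g.+1) :
    free_set g :=
  dehomogenize_set (Timage W H).

Definition arveson_boundary {g} (D : free_set g) : free_set g :=
  fun n => [set X | D n X /\
    forall m (beta : 'I_g -> 'M[R]_(n, m)) (gamma : mxtuple g m),
      SM gamma ->
      D (n + m)%N (fun i => block_mx (X i) (beta i) (beta i)^T (gamma i)) ->
      forall i, beta i = 0].

End FreeSpectrahedra.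

Arguments mxtuple : clear implicits.
Arguments free_set : clear implicits.

(* Main.v *)
(* Write H for the homogenization of D_A and K = T_W(H). Both are matrix convex
   cones containing (I, 0), and boundedness of their slices at X_0 = I gives
   |x_i| <= c x_0 on their first levels; compressing to vectors, X_0 is positive
   semidefinite and ker X_0 is the joint kernel of the X_i at every level. Since
   W is invertible, T_W(I, X) has no joint kernel, so its 0-th component Z_0 is
   positive definite and (I, P_W(X)) is congruent to T_W(I, X) by Z_0^{-1/2}.
   Finally X is in the Arveson boundary of a slice exactly when every dilation of
   (I, X) in the cone has off-diagonal block (X_i M)_i for some matrix M, and
   this property is invariant under congruences and under T_W. *)

Require Import Defs.
From mathcomp Require Import all_boot all_order all_algebra.
From mathcomp Require Import all_classical all_reals all_analysis.
From mathcomp Require Import complex ring lra.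

Set Implicit Arguments.
Unset Strict Implicit.
Unset Printing Implicit Defensive.

Import Order.TTheory GRing.Theory Num.Theory.

Local Open Scope classical_set_scope.
Local Open Scope ring_scope.

(** * Positive semidefinite matrices and their square roots *)

Section PsdMatrices.
Context {R : realType}.

Lemma psd_conj m n (M : 'M[R]_n) (V : 'M[R]_(n, m)) :
  psd M -> psd (V^T *m M *m V).
Proof.
case=> symM posM; split; first by rewrite !trmx_mul trmxK symM mulmxA.
by move=> v; have := posM (V *m v); rewrite trmx_mul !mulmxA.
Qed.

Lemma psdD n (M N : 'M[R]_n) : psd M -> psd N -> psd (M + N).
Proof.
case=> symM posM [symN posN]; split; first by rewrite linearD /= symM symN.
by move=> v; rewrite mulmxDr mulmxDl mxE addr_ge0.
Qed.

Lemma psd1 n : psd (1%:M : 'M[R]_n).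
Proof.
split=> [|v]; first by rewrite trmx1.
by rewrite mulmx1 mxE sumr_ge0 // => i _; rewrite mxE -expr2 sqr_ge0.
Qed.

Lemma psd_sqr n (T : 'M[R]_n) : T^T = T -> psd (T *m T).
Proof.
by move=> symT; have := psd_conj T (psd1 n); rewrite mulmx1 symT.
Qed.

(* If v^T M v = 0, then 0 <= (w + t v)^T M (w + t v) is affine in t. *)
Lemma psd_ker n (M : 'M[R]_n) (v : 'cV[R]_n) :
  psd M -> (v^T *m M *m v) 0 0 = 0 -> M *m v = 0.
Proof.
move=> [symM posM] v0.
suff E (w : 'cV[R]_n) : (w^T *m M *m v) 0 0 = 0.
  apply/colP=> i; have := E (delta_mx i 0).
  by rewrite -mulmxA trmx_delta -rowE !mxE.
have sym : (v^T *m M *m w) 0 0 = (w^T *m M *m v) 0 0.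
  transitivity ((v^T *m M *m w)^T 0 0); first by rewrite [RHS]mxE.
  by rewrite !trmx_mul trmxK symM mulmxA.
set a := (w^T *m M *m v) 0 0 in sym *; pose b := (w^T *m M *m w) 0 0.
have quad t : 0 <= b + 2 * t * a.
  have := posM (w + t *: v).
  have -> : (w + t *: v)^T = w^T + t *: v^T by rewrite linearD linearZ.
  rewrite !(mulmxDl, mulmxDr) -!(scalemxAl, scalemxAr).
  have D00 (A B : 'M[R]_1) : (A + B) 0 0 = A 0 0 + B 0 0 by rewrite mxE.
  have Z00 c (A : 'M[R]_1) : (c *: A) 0 0 = c * A 0 0 by rewrite mxE.
  rewrite !(D00, Z00) -/a -/b sym v0; lra.
(* This value of t makes the affine function b + 2ta equal to -1. *)
apply/eqP/negPn/negP=> a0; have := quad (- (b + 1) / (2 * a)).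
suff -> : 2 * (- (b + 1) / (2 * a)) * a = - (b + 1) by lra.
by field.
Qed.


Lemma mx_unit_ker n (M : 'M[R]_n) :
  (forall v : 'cV[R]_n, M *m v = 0 -> v = 0) -> M \in unitmx.
Proof.
move=> kerM; rewrite -unitmx_tr -row_free_unit -kermx_eq0.
apply/eqP/row_matrixP=> i.
rewrite row0; apply: trmx_inj; rewrite trmx0; apply: kerM; apply: trmx_inj.
by rewrite trmx_mul trmxK trmx0 -row_mul mulmx_ker row0.
Qed.

(** Used to write a function of the eigenvalues of a symmetric matrix as a polynomial in that
    matrix, which keeps it real and symmetric. Induction on the nodes: a new node is corrected by a
    multiple of the polynomial that vanishes at the old ones. *)
Lemma interpolation (F : fieldType) (s : seq F) (f : F -> F) :
  exists p : {poly F}, {in s, forall x, p.[x] = f x}.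
Proof.
elim: s => [|a s [p ps]]; first by exists 0.
have [as_ | aNs] := boolP (a \in s).
  by exists p => x; rewrite inE => /orP[/eqP->|]; apply: ps.
pose q := \prod_(x <- s) ('X - x%:P).
have q_root x : x \in s -> q.[x] = 0.
  by move=> xs; apply/eqP; rewrite -/(root q x) root_prod_XsubC.
have qa : q.[a] != 0 by rewrite -/(root q a) root_prod_XsubC.
exists (p + ((f a - p.[a]) / q.[a]) *: q) => x; rewrite inE hornerD hornerZ.
case: eqP => [-> _|_ /= xs]; first by rewrite divfK // addrC subrK.
by rewrite (q_root x) // mulr0 addr0 ps.
Qed.

Lemma trmx_horner n (M : 'M[R]_n.+1) (p : {poly R}) :
  M^T = M -> (horner_mx M p)^T = horner_mx M p.
Proof.
move=> symM; elim/poly_ind: p => [|p c IH]; first by rewrite rmorph0 trmx0.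
rewrite rmorphD rmorphM /= horner_mx_X horner_mx_C linearD /= trmx_mul.
rewrite tr_scalar_mx symM IH; congr (_ + _).
exact/comm_mx_horner/comm_mx_refl.
Qed.

(** Over R[i] the matrix is Hermitian, so it is unitarily diagonalizable with real eigenvalues. The
    base change [P] stays complex; similarity is enough to evaluate polynomials at [M]. *)
Lemma symmetric_diagonalization n (M : 'M[R]_n.+1) : M^T = M ->
  exists (P : 'M[R[i]]_n.+1) (l : 'rV[R]_n.+1), P \in unitmx /\
    map_mx (real_complex R) M =
    invmx P *m diag_mx (map_mx (real_complex R) l) *m P.
Proof.
move=> symM; set MC := map_mx _ M.
have hMC : MC \is hermsymmx.
  apply: realsym_hermsym.
    apply/is_hermitianmxP; rewrite expr0 scale1r.
    by apply/matrixP=> i j; rewrite !mxE -{1}symM mxE.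
  by apply/mxOverP=> i j; rewrite mxE; apply/complex_realP; exists (M i j).
have /hermitian_normalmx /orthomx_spectralP eqMC := hMC.
have /mxOverP reD := hermitian_spectral_diag_real hMC.
exists (spectralmx MC), (map_mx (@complex.Re R) (spectral_diag MC)).
split; first exact: spectral_unit.
suff -> : map_mx (real_complex R) (map_mx (@complex.Re R) (spectral_diag MC)) =
  spectral_diag MC by [].
by apply/matrixP=> i j; rewrite !mxE RRe_real // reD.
Qed.

(** Here [T] is a polynomial in [M], hence symmetric. A fourth root rather than a square root is
    taken because [T *m T], as the square of a symmetric matrix, is then psd without looking at the
    spectrum of [T]. *)
Lemma psd_fourth_root n (M : 'M[R]_n) : psd M ->
  exists2 T : 'M[R]_n, T^T = T & T *m T *m (T *m T) = M.
Proof.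
case: n M => [|n] M [symM posM].
  by exists M => //; rewrite [LHS]flatmx0 [RHS]flatmx0.
have [P [l [uP eqM]]] := symmetric_diagonalization symM.
(* Row i of [P] is a complex left eigenvector. Being an eigenvalue descends to R, which gives a real
   eigenvector v, and v M v^T = l_i v v^T. *)
have l_ge0 i : 0 <= l 0 i.
  have /eigenvalueP[v vM v0] : eigenvalue M (l 0 i).
    rewrite -(eigenvalue_map (real_complex R)); apply/eigenvalueP.
    exists (row i P).
      rewrite eqM !mulmxA -row_mul mulmxV // row1 -rowE row_diag_mx -scalemxAl.
      by rewrite -rowE mxE.
    apply/eqP=> P0; have := row_mul i P (invmx P).
    rewrite mulmxV // P0 mul0mx => /rowP/(_ i)/eqP.
    by rewrite !mxE eqxx oner_eq0.
  have := posM v^T; rewrite trmxK vM -scalemxAl mxE.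
  have vv_gt0 : 0 < (v *m v^T) 0 0.
    have [j vj] : exists j, v 0 j != 0.
      apply/existsP; apply: contraNT v0 => /existsPn vj0.
      by apply/eqP/rowP=> j; rewrite mxE; apply/eqP/negPn/vj0.
    rewrite mxE (bigD1 j) //= mxE ltr_wpDr ?sumr_ge0 //.
      by move=> k _; rewrite mxE -expr2 sqr_ge0.
    by rewrite -expr2 lt_def sqr_ge0 expf_neq0.
  by rewrite pmulr_lge0.
have [p pl] := interpolation [seq l 0 i | i <- enum 'I_n.+1]
  (fun x => Num.sqrt (Num.sqrt x)).
have hM : horner_mx M (p ^+ 4) = M.
  apply: (map_mx_inj (f := real_complex R)); rewrite map_horner_mx eqM.
  rewrite -{2}(invmxK P) horner_mx_uconj ?unitmx_inv // horner_mx_diag invmxK.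
  congr (_ *m diag_mx _ *m _); apply/matrixP=> i j.
  rewrite ord1 !mxE horner_map.
  rewrite horner_exp pl; last by apply/mapP; exists j; rewrite ?mem_enum.
  by rewrite (exprM _ 2 2) !sqr_sqrtr ?sqrtr_ge0.
exists (horner_mx M p); first exact: trmx_horner.
by rewrite -[RHS]hM rmorphXn /= (exprM _ 2 2) !expr2.
Qed.

Lemma psd_sqrt_exists n (M : 'M[R]_n) : psd M -> exists S, psd S /\ S *m S = M.
Proof.
case/psd_fourth_root=> T symT TM; exists (T *m T).
by split=> //; apply: psd_sqr.
Qed.

Lemma psd_diag_ge0 n (M : 'M[R]_n) i : psd M -> 0 <= M i i.
Proof.
case=> _ /(_ (delta_mx i 0)).
by rewrite trmx_delta -rowE -colE !mxE.
Qed.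

(** The diagonal entries are nonnegative with sum 0, so each e_j^T M e_j vanishes and [psd_ker]
    kills column j. *)
Lemma psd_mxtrace0 n (M : 'M[R]_n) : psd M -> \tr M = 0 -> M = 0.
Proof.
move=> psdM trM; apply/matrixP=> i j.
have : M *m delta_mx j 0 = 0 :> 'cV_n.
  apply: psd_ker => //; rewrite trmx_delta -rowE -colE !mxE.
  apply/eqP; move: trM; rewrite /mxtrace => /eqP.
  rewrite psumr_eq0 => [/allP/(_ j)|k _]; last exact: psd_diag_ge0.
  by rewrite mem_index_enum => /(_ isT).
by rewrite -colE => /colP/(_ i); rewrite !mxE.
Qed.

(* D = S - T anticommutes with S + T, so tr (D (S + T) D) = 0. Hence
   D S D = D T D = 0, then S D = T D = 0, and D^2 = 0. *)
Lemma psd_sqrt_unique n (S T : 'M[R]_n) :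
  psd S -> psd T -> S *m S = T *m T -> S = T.
Proof.
move=> psdS psdT ST; pose D := S - T.
have symD : D^T = D by rewrite /D linearB /= psdS.1 psdT.1.
have anti : D *m (S + T) = - ((S + T) *m D).
  apply/eqP; rewrite -addr_eq0 /D mulmxBl !mulmxDr !mulmxDl !mulmxN ST.
  by apply/eqP/matrixP=> i j; rewrite !mxE; ring.
have tr0 : \tr (D *m (S + T) *m D) = 0.
  set t := \tr _; suff : t = - t by lra.
  by rewrite {1}/t mxtrace_mulC anti mulmxN linearN /= mulmxA.
have psdDSTD : psd (D *m (S + T) *m D).
  by rewrite -{1}symD; apply/psd_conj/psdD.
have DSTD0 := psd_mxtrace0 psdDSTD tr0.
have colD0 j : S *m col j D = T *m col j D.
  have : (col j D)^T *m S *m col j D + (col j D)^T *m T *m col j D = 0.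
    rewrite -mulmxDl -mulmxDr colE trmx_mul symD.
    by rewrite mulmxA -!(mulmxA (delta_mx j 0)^T) DSTD0 mul0mx mulmx0.
  move=> /matrixP/(_ 0 0); rewrite mxE [RHS]mxE => /eqP.
  rewrite paddr_eq0 ?psdS.2 ?psdT.2 // => /andP[/eqP S0 /eqP T0].
  by rewrite !psd_ker.
suff D0 : D = 0 by apply/eqP; rewrite -subr_eq0 -/D D0.
apply/matrixP=> i j; suff : col j D = 0 by move=> /colP/(_ i); rewrite !mxE.
rewrite -[LHS]mul1mx; apply: psd_ker; first exact: psd1.
have DD0 : D *m col j D = 0 by rewrite mulmxBl colD0 subrr.
by rewrite mulmx1 {1}colE trmx_mul symD -mulmxA DD0 mulmx0 mxE.
Qed.

Lemma psd_sqrtP n (M : 'M[R]_n) : psd M ->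
  psd (psd_sqrt M) /\ psd_sqrt M *m psd_sqrt M = M.
Proof.
move=> psdM.
exact: (@xgetPex _ 0 [set S | psd S /\ S *m S = M] (psd_sqrt_exists psdM)).
Qed.

Lemma psd_sqrtE n (S : 'M[R]_n) : psd S -> psd_sqrt (S *m S) = S.
Proof.
move=> psdS; have [psdT TS] := psd_sqrtP (psd_sqr psdS.1).
exact: psd_sqrt_unique.
Qed.

Lemma moore_penrose_unit n (M : 'M[R]_n) : M \in unitmx ->
  moore_penrose M = invmx M.
Proof.
move=> uM; have : is_moore_penrose M (moore_penrose M).
  rewrite /moore_penrose; apply: (@xgetPex _ 0 [set P | is_moore_penrose M P]).
  by exists (invmx M); split; rewrite ?mulmxV ?mulVmx ?mul1mx ?trmx1.
case=> MPM _ _ _; apply: (can_inj (mulKmx uM)); apply: (can_inj (mulmxK uM)).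
by rewrite MPM mulmxV ?mul1mx.
Qed.

Lemma psd_invmx n (M : 'M[R]_n) : psd M -> psd (invmx M).
Proof.
(* For singular [M], [invmx M] is [M] itself; otherwise the inverse is congruent to [M] by
   itself. *)
move=> psdM; have [uM | NuM] := boolP (M \in unitmx); last by rewrite invmx_out.
have := psd_conj (invmx M) psdM.
by rewrite -mulmxA mulmxV // mulmx1 trmx_inv psdM.1.
Qed.

End PsdMatrices.

(** * Matrix convex cones with a bounded slice *)

Section MatrixCones.
Context {R : realType}.

Definition compress g n m (V : 'M[R]_(n, m)) (Z : mxtuple R g n) :
    mxtuple R g m :=
  fun i => V^T *m Z i *m V.

Definition tuple_add g n (Z Z' : mxtuple R g n) : mxtuple R g n :=
  fun i => Z i + Z' i.

(** The properties shared by H and T_W(H) through which both are handled. Rectangular [V] covers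
    congruences, compression to vectors and nonnegative scalings at once. *)
Record matrix_cone g (H : free_set R g) : Prop := MatrixCone {
  cone_SM : forall n Z, H n Z -> SM Z;
  cone_compress : forall n m (V : 'M[R]_(n, m)) Z,
    (0 < m)%N -> H n Z -> H m (compress V Z);
  cone_add : forall n Z Z', H n Z -> H n Z' -> H n (tuple_add Z Z') }.

Lemma compress1 g n (Z : mxtuple R g n) : compress 1%:M Z = Z.
Proof. by apply/funext=> i; rewrite /compress trmx1 mul1mx mulmx1. Qed.

Lemma compressM g n m p (V : 'M[R]_(n, m)) (V' : 'M[R]_(m, p))
    (Z : mxtuple R g n) :
  compress V' (compress V Z) = compress (V *m V') Z.
Proof. by apply/funext=> i; rewrite /compress trmx_mul !mulmxA. Qed.

Lemma hom_free_spectrahedron_cone g d (B : mxtuple R g.+1 d) :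
  matrix_cone (hom_free_spectrahedron B).
Proof.
split=> [n Z []//|n m V Z m0 [[n0 symZ] psdZ]|].
- split; first by split=> // i; rewrite !trmx_mul trmxK symZ mulmxA.
  suff -> : \sum_i B i *t compress V Z i =
      (1%:M *t V)^T *m (\sum_i B i *t Z i) *m (1%:M *t V) by exact: psd_conj.
  rewrite mulmx_sumr mulmx_suml; apply: eq_bigr => i _.
  by rewrite trmx_tens trmx1 !tensmx_mul mul1mx mulmx1.
- move=> n Z Z' [[n0 symZ] psdZ] [[_ symZ'] psdZ'].
  split; first by split=> // i; rewrite linearD /= symZ symZ'.
  suff -> : \sum_i B i *t tuple_add Z Z' i =
      \sum_i B i *t Z i + \sum_i B i *t Z' i by exact: psdD.
  rewrite -big_split; apply: eq_bigr => i _.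
  by apply/matrixP=> k l; rewrite !mxE mulrDr.
Qed.

Definition unit_tuple g n : mxtuple R g.+1 n := homogenize (fun=> 0).

Lemma homogenize0 g n (X : mxtuple R g n) : homogenize X ord0 = 1%:M.
Proof. by rewrite /homogenize unlift_none. Qed.

Lemma homogenize_lift g n (X : mxtuple R g n) j :
  homogenize X (lift ord0 j) = X j.
Proof. by rewrite /homogenize liftK. Qed.

Lemma unit_tuple0 g n : @unit_tuple g n ord0 = 1%:M.
Proof. exact: homogenize0. Qed.

Lemma unit_tuple_lift g n j : @unit_tuple g n (lift ord0 j) = 0.
Proof. exact: homogenize_lift. Qed.

Lemma homogenizeP g n (X : mxtuple R g n) (Z : mxtuple R g.+1 n) :
  Z ord0 = 1%:M -> (forall j, Z (lift ord0 j) = X j) -> homogenize X = Z.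
Proof.
move=> Z0 ZX; apply/funext=> i.
by case: (unliftP ord0 i) => [j|] ->; rewrite ?homogenize0 ?homogenize_lift.
Qed.

Lemma Lpencil_homogenize g d n (A : mxtuple R g d) (X : mxtuple R g n) :
  \sum_i homogenize A i *t homogenize X i = Lpencil A X.
Proof.
rewrite big_ord_recl !homogenize0; congr (_ + _).
  apply/matrixP=> i j; case: (mxtens_indexP i) => i0 i1.
  case: (mxtens_indexP j) => j0 j1; rewrite tensmxE !mxE.
  by rewrite (can_eq (@mxtens_indexK _ _)) -natrM mulnb.
by apply: eq_bigr => i _; rewrite !homogenize_lift.
Qed.

Lemma SM_homogenize g n (X : mxtuple R g n) : SM (homogenize X) <-> SM X.
Proof.
split=> [] [n0 symX]; split=> // i.
  by rewrite -(homogenize_lift X) symX.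
by case: (unliftP ord0 i) => [j|] ->;
  rewrite ?homogenize0 ?homogenize_lift ?symX ?trmx1.
Qed.

Lemma free_spectrahedron_dehomogenize g d (A : mxtuple R g d) :
  free_spectrahedron A =
  dehomogenize_set (hom_free_spectrahedron (homogenize A)).
Proof.
apply: functional_extensionality_dep => n; apply/seteqP; split=> X /=.
  case=> SMX psdX; split=> //; split; rewrite ?Lpencil_homogenize //.
  exact/SM_homogenize.
by case=> SMX [_]; rewrite Lpencil_homogenize.
Qed.

Section Cone.
Variables (g : nat) (H : free_set R g.+1).
Hypothesis coneH : matrix_cone H.

Lemma cone_scale n (Z : mxtuple R g.+1 n) (s : R) :
  0 <= s -> H Z -> H (fun i => s *: Z i).
Proof.
move=> s0 HZ; have [n0 _] := cone_SM coneH HZ.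
suff -> : (fun i => s *: Z i) = compress (Num.sqrt s)%:M Z.
  exact: cone_compress.
apply/funext=> i; rewrite /compress tr_scalar_mx mul_scalar_mx mul_mx_scalar.
by rewrite scalerA -expr2 sqr_sqrtr.
Qed.

Hypothesis H1 : H (@unit_tuple g 1).

(** I_n is the sum of the matrices e_k e_k^T, each a compression of the unit of size 1 by a row
    vector; the zero tuple starts the sum. *)
Lemma cone_unit n : (0 < n)%N -> H (@unit_tuple g n).
Proof.
move=> n0.
have H0 : H (fun _ : 'I_g.+1 => 0 : 'M[R]_n).
  suff -> : (fun=> 0) = compress (0 : 'M[R]_(1, n)) (@unit_tuple g 1).
    exact: cone_compress.
  by apply/funext=> i; rewrite /compress mulmx0.
have -> : @unit_tuple g n =
    fun i => \sum_(k < n) compress (delta_mx 0 k) (@unit_tuple g 1) i.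
  apply: homogenizeP => [|j].
    rewrite (eq_bigr (fun k => delta_mx k k)); first by rewrite -mx1_sum_delta.
    by move=> k _; rewrite /compress unit_tuple0 mulmx1 trmx_delta mul_delta_mx.
  by rewrite big1 // => k _; rewrite /compress unit_tuple_lift mulmx0 mul0mx.
elim: (index_enum _) => [|k r IH].
  by under eq_fun do rewrite big_nil.
under eq_fun do rewrite big_cons.
apply: (@cone_add _ _ coneH n (compress _ _)) => //.
exact: cone_compress.
Qed.

Section Bounded.
Hypothesis bndH : bounded_free_set (dehomogenize_set H).
Hypothesis HN1 : ~ H (fun i => - @unit_tuple g 1 i).

(** If s >= 0 and s z_0 <= 1, adding (1 - s z_0)(1, 0, ..., 0) to s z gives a point of the slice, so
    (s z_j)^2 <= C and s |z_j| <= C + 1. The bound follows by choosing s as large as allowed. *)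
Lemma level1_bound : exists2 c : R, 0 < c &
  forall z : mxtuple R g.+1 1, H z -> forall i, `|z i 0 0| <= c * z ord0 0 0.
Proof.
have [C [C0 boundC]] := bndH.
have slice (z : mxtuple R g.+1 1) s (j : 'I_g) :
    H z -> 0 <= s -> s * z ord0 0 0 <= 1 ->
    s * `|z (lift ord0 j) 0 0| <= C + 1.
  move=> Hz s0 sz; pose X (k : 'I_g) : 'M[R]_1 := s *: z (lift ord0 k).
  have hX : homogenize X = tuple_add (fun i => s *: z i)
      (fun i => (1 - s * z ord0 0 0) *: @unit_tuple g 1 i).
    apply: homogenizeP => [|k]; rewrite /tuple_add ?unit_tuple0 ?unit_tuple_lift.
      by apply/matrixP=> a b; rewrite !ord1 !mxE mulr1 addrC subrK.
    by rewrite scaler0 addr0.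
  have HX : H (homogenize X).
    by rewrite hX; apply: cone_add => //; apply: cone_scale; rewrite ?subr_ge0.
  have DX : dehomogenize_set H 1%N X.
    by split=> //; apply/SM_homogenize/(cone_SM coneH).
  have := psd_diag_ge0 0 (boundC _ _ DX).
  rewrite !mxE eqxx mulr1n subr_ge0 summxE (bigD1 j) //=.
  set S := \sum_(_ | _) _; have S0 : 0 <= S.
    by apply: sumr_ge0 => k _; rewrite mxE big_ord1 -expr2 sqr_ge0.
  rewrite mxE big_ord1 !mxE => le.
  have {le} : (s * `|z (lift ord0 j) 0 0|) ^+ 2 <= C.
    by rewrite exprMn real_normK ?num_real // -exprMn expr2; lra.
  set y := s * _ => le; rewrite leNgt; apply/negP=> gt; nra.
(* For z_0 < 0 every s >= 0 is allowed, so each z_j with j > 0 vanishes: otherwise s = (C + 2) /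
   |z_j| would give C + 2 <= C + 1. Then a positive multiple of z is (-1, 0, ..., 0), which is
   excluded. *)
have z0_ge0 (z : mxtuple R g.+1 1) : H z -> 0 <= z ord0 0 0.
  move=> Hz; rewrite leNgt; apply/negP=> z0; apply: HN1.
  suff -> : (fun i => - @unit_tuple g 1 i) =
      (fun i => (- (z ord0 0 0)^-1) *: z i).
    by apply: cone_scale => //; rewrite oppr_ge0 invr_le0 ltW.
  apply/funext=> i; apply/matrixP=> a b; rewrite !ord1 !mxE.
  case: (unliftP ord0 i) => [j|] ->.
    rewrite unit_tuple_lift !mxE oppr0; apply/esym/eqP; rewrite mulf_eq0.
    apply/orP; right; rewrite -normr_le0 leNgt; apply/negP=> zj.
    have := slice z ((C + 2) / `|z (lift ord0 j) 0 0|) j Hz.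
    rewrite divfK ?gt_eqF // => /(_ _ _) le; suff : C + 2 <= C + 1 by lra.
    have s0 : 0 <= (C + 2) / `|z (lift ord0 j) 0 0|.
      by rewrite divr_ge0 //; lra.
    by apply: le => //; nra.
  by rewrite unit_tuple0 mxE mulNr mulVf // lt_eqF.
exists (C + 1) => [|z Hz i]; first lra.
have z0 := z0_ge0 z Hz.
case: (unliftP ord0 i) => [j|] ->; last by rewrite ger0_norm //; nra.
(* As z_0 may be 0, the scaling factor is 1 / (z_0 + e / (C + 1)) with e > 0 arbitrary. *)
apply/ler_addgt0Pr => e e0.
have d0 : 0 < z ord0 0 0 + e / (C + 1) by rewrite ltr_wpDl // divr_gt0 //; lra.
have := slice z (z ord0 0 0 + e / (C + 1))^-1 j Hz.
rewrite ler_pdivrMl // ler_pdivrMl // mulr1 invr_ge0 (ltW d0) => /(_ isT).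
rewrite lerDl divr_ge0 ?(ltW e0) ?addr_ge0 ?(ltW C0) //.
move=> /(_ isT).
suff -> : (z ord0 0 0 + e / (C + 1)) * (C + 1) =
    (C + 1) * z ord0 0 0 + e by [].
by field; lra.
Qed.

Lemma cone_psd0 n (Z : mxtuple R g.+1 n) : H Z -> psd (Z ord0).
Proof.
have [c c0 bound] := level1_bound => HZ; have [n0 symZ] := cone_SM coneH HZ.
split=> // v; have := bound _ (cone_compress coneH v isT HZ) ord0.
by rewrite -(pmulr_rge0 _ c0); apply: le_trans.
Qed.

(** Applied to compressions by vectors, the level 1 bound makes c Z_0 + Z_i psd. Its form vanishes
    at v when Z_0 v = 0, so it kills v. *)
Lemma cone_ker n (Z : mxtuple R g.+1 n) (v : 'cV_n) :
  H Z -> Z ord0 *m v = 0 -> forall i, Z i *m v = 0.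
Proof.
have [c c0 bound] := level1_bound => HZ Z0v i.
have bnd (w : 'cV[R]_n) :
    `|(w^T *m Z i *m w) 0 0| <= c * (w^T *m Z ord0 *m w) 0 0.
  exact: bound _ (cone_compress coneH w isT HZ) i.
have formE (w : 'cV[R]_n) : (w^T *m (c *: Z ord0 + Z i) *m w) 0 0 =
    c * (w^T *m Z ord0 *m w) 0 0 + (w^T *m Z i *m w) 0 0.
  by rewrite mulmxDr mulmxDl -scalemxAr -scalemxAl mxE [X in X + _]mxE.
have [n0 symZ] := cone_SM coneH HZ.
have : (c *: Z ord0 + Z i) *m v = 0.
  apply: psd_ker.
    split=> [|w]; first by rewrite linearD linearZ /= !symZ.
    rewrite formE -lerBlDr sub0r (le_trans _ (bnd w)) //.
    by rewrite -normrN ler_norm.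
  have q0 : (v^T *m Z ord0 *m v) 0 0 = 0 by rewrite -mulmxA Z0v mulmx0 mxE.
  by have := bnd v; rewrite formE q0 mulr0 add0r normr_le0 => /eqP.
by rewrite mulmxDl -scalemxAl Z0v scaler0 add0r.
Qed.

Lemma cone_unitmx n (Z : mxtuple R g.+1 n) : H Z ->
  (forall v : 'cV_n, (forall i, Z i *m v = 0) -> v = 0) -> Z ord0 \in unitmx.
Proof. by move=> HZ kerZ; apply: mx_unit_ker => v /(cone_ker HZ)/kerZ. Qed.

End Bounded.
End Cone.
End MatrixCones.

(** * The homogeneous Arveson property *)

Section Arveson.
Context {R : realType}.

Lemma psdD1_unit n (M : 'M[R]_n) : psd M -> M + 1%:M \in unitmx.
Proof.
move=> psdM; apply: mx_unit_ker => v Mv; rewrite -[v]mul1mx.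
apply: psd_ker; first exact: psd1.
have : (v^T *m M *m v + v^T *m 1%:M *m v) 0 0 = 0.
  by rewrite -mulmxDl -mulmxDr -mulmxA Mv mulmx0 mxE.
rewrite mxE => /eqP; rewrite paddr_eq0 ?psdM.2 ?(psd1 _).2 //.
by case/andP=> _ /eqP.
Qed.

Lemma psd_inv_sqrt n (M : 'M[R]_n) : psd M -> M \in unitmx ->
  let S := psd_sqrt (invmx M) in
  [/\ psd S, S \in unitmx & S *m M *m S = 1%:M].
Proof.
move=> psdM uM S; have [psdS SS] := psd_sqrtP (psd_invmx psdM).
have S_MS : S *m (S *m M) = 1%:M by rewrite mulmxA SS mulVmx.
have [uS _] := mulmx1_unit S_MS.
by split=> //; apply: mulmx1C.
Qed.

Definition dilation g n m (Q : mxtuple R g n) (beta : 'I_g -> 'M[R]_(n, m))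
    (gamma : mxtuple R g m) : mxtuple R g (n + m) :=
  fun i => block_mx (Q i) (beta i) (beta i)^T (gamma i).

(* The version of the Arveson property that survives congruences and linear
   changes of the coordinates: for Q_0 = I, the trivial dilations are those
   obtained from a direct sum by the congruence with the block matrix
   [[I, M], [0, I]]. *)
Definition hom_arveson g (H : free_set R g) n (Q : mxtuple R g n) : Prop :=
  forall m (beta : 'I_g -> 'M[R]_(n, m)) (gamma : mxtuple R g m), (0 < m)%N ->
    H (n + m)%N (dilation Q beta gamma) ->
    exists M : 'M[R]_(n, m), forall i, beta i = Q i *m M.

(** The congruence by S^{-1} + I (direct sum) turns a dilation of S^T Q S into one of Q with
    off-diagonal block S^{-T} beta_i = Q_i M. Hence beta_i = (S^T Q_i S) S^{-1} M. *)
Lemma hom_arveson_compress g (H : free_set R g) n (Q : mxtuple R g n)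
    (S : 'M[R]_n) :
  matrix_cone H -> S \in unitmx -> hom_arveson H Q ->
  hom_arveson H (compress S Q).
Proof.
move=> coneH uS arvQ m beta gamma m0 Hdil.
have [M betaM] : exists M, forall i, (invmx S)^T *m beta i = Q i *m M.
  apply: (arvQ m _ gamma) => //.
  have nm0 : (0 < n + m)%N by rewrite addn_gt0 m0 orbT.
  suff <- : compress (block_mx (invmx S) 0 0 1%:M)
      (dilation (compress S Q) beta gamma) =
      dilation Q (fun i => (invmx S)^T *m beta i) gamma.
    exact: cone_compress.
  apply/funext=> i; rewrite /compress /dilation tr_block_mx !mulmx_block.
  rewrite !trmx0 trmx1 trmx_mul trmxK.
  rewrite !(mulmx0, mul0mx, mul1mx, mulmx1, addr0, add0r) !mulmxA.
  by rewrite -trmx_mul mulmxV // trmx1 mul1mx mulmxK.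
exists (invmx S *m M) => i; rewrite /compress mulmxA mulmxK // -mulmxA -betaM.
by rewrite mulmxA -trmx_mul mulVmx // trmx1 mul1mx.
Qed.

(** * Linear changes of the coordinates of a tuple *)

Lemma Timage_Tmap g (W : 'M[R]_g) (H : free_set R g) n (Z : mxtuple R g n) :
  H n Z -> Timage W H n (Tmap W Z).
Proof. by move=> HZ; exists Z. Qed.

(** Rectangular blocks are allowed so that this also serves the off-diagonal part of a dilation. *)
Lemma linear_combM g n m (W W' : 'M[R]_g) (b : 'I_g -> 'M[R]_(n, m)) i :
  \sum_j W i j *: (\sum_k W' j k *: b k) = \sum_k (W *m W') i k *: b k.
Proof.
under eq_bigr do rewrite scaler_sumr; rewrite exchange_big.
apply: eq_bigr => k _.
by rewrite mxE scaler_suml; apply: eq_bigr => j _; rewrite scalerA.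
Qed.

Lemma linear_comb1 g n m (b : 'I_g -> 'M[R]_(n, m)) i :
  \sum_j (1%:M : 'M[R]_g) i j *: b j = b i.
Proof.
rewrite (bigD1 i) //= mxE eqxx scale1r big1 ?addr0 // => j ji.
by rewrite mxE eq_sym (negbTE ji) scale0r.
Qed.

Lemma TmapM g n (W W' : 'M[R]_g) (Z : mxtuple R g n) :
  Tmap W (Tmap W' Z) = Tmap (W *m W') Z.
Proof. by apply/funext=> i; apply: linear_combM. Qed.

Lemma Tmap1 g n (Z : mxtuple R g n) : Tmap 1%:M Z = Z.
Proof. by apply/funext=> i; apply: linear_comb1. Qed.

Lemma TmapK g n (W : 'M[R]_g) (Z : mxtuple R g n) : W \in unitmx ->
  Tmap (invmx W) (Tmap W Z) = Z.
Proof. by move=> uW; rewrite TmapM mulVmx ?Tmap1. Qed.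

Lemma TmapKV g n (W : 'M[R]_g) (Z : mxtuple R g n) : W \in unitmx ->
  Tmap W (Tmap (invmx W) Z) = Z.
Proof. by move=> uW; rewrite TmapM mulmxV ?Tmap1. Qed.

Lemma TimageE g (W : 'M[R]_g) (H : free_set R g) n (Z : mxtuple R g n) :
  W \in unitmx -> Timage W H n Z <-> H n (Tmap (invmx W) Z).
Proof.
move=> uW; split=> [[Z' HZ' <-]|HZ]; first by rewrite TmapK.
by exists (Tmap (invmx W) Z) => //; rewrite TmapKV.
Qed.

Lemma TimageK g (W : 'M[R]_g) (H : free_set R g) : W \in unitmx ->
  Timage (invmx W) (Timage W H) = H.
Proof.
move=> uW; apply: functional_extensionality_dep => n.
apply/seteqP; split=> Z /=.
  move/(TimageE _ _); rewrite unitmx_inv invmxK => /(_ uW).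
  by move/(TimageE _ _ uW); rewrite TmapK.
move=> HZ; apply/TimageE; rewrite ?unitmx_inv // invmxK; exact: Timage_Tmap.
Qed.

Lemma Tmap_compress g n m (W : 'M[R]_g) (V : 'M[R]_(n, m)) (Z : mxtuple R g n) :
  Tmap W (compress V Z) = compress V (Tmap W Z).
Proof.
apply/funext=> i; rewrite /compress /Tmap mulmx_sumr mulmx_suml.
by apply: eq_bigr => j _; rewrite -scalemxAr -scalemxAl.
Qed.

Lemma Tmap_dilation g n m (W : 'M[R]_g) (Q : mxtuple R g n)
    (b : 'I_g -> 'M[R]_(n, m)) (c : mxtuple R g m) :
  Tmap W (dilation Q b c) =
  dilation (Tmap W Q) (fun i => \sum_j W i j *: b j) (Tmap W c).
Proof.
apply/funext=> i; rewrite /Tmap /dilation.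
elim: (index_enum _) => [|j r IH].
  by rewrite !big_nil trmx0 block_mx0.
by rewrite !big_cons IH scale_block_mx add_block_mx linearD linearZ.
Qed.

(** [Tmap] acts on each block of a dilation separately, and beta_i = Q_i M is linear in the
    coordinate, so the same [M] works before and after. *)
Lemma hom_arveson_Timage g (W : 'M[R]_g) (H : free_set R g) n
    (Q : mxtuple R g n) : W \in unitmx ->
  hom_arveson H Q -> hom_arveson (Timage W H) (Tmap W Q).
Proof.
move=> uW arvQ m beta gamma m0 /(TimageE _ _ uW) Hdil.
have [M betaM] : exists M, forall i,
    \sum_j (invmx W) i j *: beta j = Q i *m M.
  apply: (arvQ m _ (Tmap (invmx W) gamma)) => //.
  by move: Hdil; rewrite Tmap_dilation TmapK.
exists M => i; rewrite -[LHS]linear_comb1 -(mulmxV uW) -linear_combM.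
under eq_bigr do rewrite betaM scalemxAl.
by rewrite -mulmx_suml.
Qed.

Section Dehomogenize.
Variables (g : nat) (H : free_set R g.+1).
Hypotheses (coneH : matrix_cone H) (H1 : H (@unit_tuple R g 1))
  (bndH : bounded_free_set (dehomogenize_set H))
  (HN1 : ~ H (fun i => - @unit_tuple R g 1 i)).

(** A dilation inside the slice has I as coordinate 0, so its beta_0 is 0 and [M] must be 0.
    Conversely, a dilation in the cone is brought into the slice by two invertible congruences, one
    clearing beta_0 and one normalizing the lower right corner of coordinate 0. *)
Lemma arveson_boundary_dehomogenize n (X : mxtuple R g n) :
  arveson_boundary (dehomogenize_set H) n X <->
  H (homogenize X) /\ hom_arveson H (homogenize X).
Proof.
have DE k (Y : mxtuple R g k) : dehomogenize_set H k Y <-> H (homogenize Y).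
  split=> [[]//|HY]; split=> //; exact/SM_homogenize/(cone_SM coneH).
split=> [[/DE HX arvX]|[HX arvX]]; last first.
  split; first exact/DE.
  move=> m beta gamma [m0 _] /DE HB.
  pose b (i : 'I_g.+1) := if unlift ord0 i is Some j then beta j else 0.
  have b0 : b ord0 = 0 by rewrite /b unlift_none.
  have bl j : b (lift ord0 j) = beta j by rewrite /b liftK.
  have [|M bM] := arvX m b (homogenize gamma) m0.
    suff -> : dilation (homogenize X) b (homogenize gamma) = homogenize
      (fun i => block_mx (X i) (beta i) (beta i)^T (gamma i)) by [].
    apply/esym/homogenizeP => [|j]; rewrite /dilation.
      by rewrite !homogenize0 b0 trmx0 -scalar_mx_block.
    by rewrite !homogenize_lift bl.
  have M0 : M = 0 by have := bM ord0; rewrite b0 homogenize0 mul1mx.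
  by move=> j; rewrite -bl bM M0 mulmx0.
(* The witness is forced, since coordinate 0 of [homogenize X] is I. The congruence by [V1]
   subtracts it, leaving b_0 = 0 and the goal b = 0. *)
split=> // m beta gamma m0 Hdil; exists (beta ord0).
have nm0 : (0 < n + m)%N by rewrite addn_gt0 m0 orbT.
pose V1 : 'M[R]_(n + m) := block_mx 1%:M (- beta ord0) 0 1%:M.
pose b i := beta i - homogenize X i *m beta ord0.
pose c : mxtuple R g.+1 m := fun i =>
  - (beta ord0)^T *m b i - (beta i)^T *m beta ord0 + gamma i.
have E1 : compress V1 (dilation (homogenize X) beta gamma) =
    dilation (homogenize X) b c.
  have [_ symX] := cone_SM coneH HX.
  have trN : (- beta ord0)^T = - (beta ord0)^T by rewrite linearN.
  apply/funext=> i; rewrite /compress /dilation /V1 tr_block_mx !mulmx_block.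
  rewrite !trmx1 !trmx0 !(mulmx0, mul0mx, mul1mx, mulmx1, addr0, add0r).
  rewrite trN /b linearB /= trmx_mul symX; congr block_mx.
  - by rewrite mulmxN addrC.
  - by rewrite mulNmx addrC.
  - rewrite /c /b mulmxDl mulNmx !mulmxN !mulmxBr !mulNmx opprK mulmxA.
    by apply/matrixP=> k l; rewrite !mxE; ring.
have Hc : H (dilation (homogenize X) b c) by rewrite -E1; apply: cone_compress.
have b0 : b ord0 = 0 by rewrite /b homogenize0 mul1mx subrr.
have Hc2 : H c.
  suff -> : c = compress (col_mx 0 1%:M) (dilation (homogenize X) b c).
    exact: cone_compress.
  apply/funext=> i; rewrite /compress /dilation tr_col_mx mul_row_block.
  rewrite mul_row_col trmx0 trmx1.
  by rewrite !(mulmx0, mul0mx, mul1mx, mulmx1, addr0, add0r).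
(* The corner c_0 is psd but possibly singular. Adding (I, 0, ..., 0) to the corner makes it
   invertible without touching [b], and the congruence by [S], the inverse square root of c_0 + I,
   makes it I. *)
have psdc := cone_psd0 coneH H1 bndH HN1 Hc2.
have [psdS uS SS] := psd_inv_sqrt (psdD psdc (psd1 m)) (psdD1_unit psdc).
set S := psd_sqrt _ in psdS uS SS.
pose c' : mxtuple R g.+1 m := fun i => S *m (c i + @unit_tuple R g m i) *m S.
pose b' i := b i *m S.
have Hb' : H (dilation (homogenize X) b' c').
  suff -> : dilation (homogenize X) b' c' = compress (block_mx 1%:M 0 0 S)
      (tuple_add (dilation (homogenize X) b c)
                 (compress (row_mx 0 1%:M) (@unit_tuple R g m))).
    apply: cone_compress => //; apply: cone_add => //.
    by apply: cone_compress => //; apply: cone_unit.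
  have corner (U : 'M[R]_m) :
      (row_mx 0 1%:M : 'M[R]_(m, n + m))^T *m U *m row_mx 0 1%:M =
      block_mx 0 0 0 U.
    rewrite tr_row_mx mul_col_mx mul_col_row !trmx0 trmx1.
    by rewrite !(mulmx0, mul0mx, mul1mx, mulmx1).
  apply/funext=> i; rewrite /tuple_add /compress /dilation corner tr_block_mx.
  rewrite add_block_mx !mulmx_block !trmx0 !trmx1 trmx_mul psdS.1.
  by rewrite !(mulmx0, mul0mx, mul1mx, mulmx1, addr0, add0r).
pose c1 : mxtuple R g m := fun j => c' (lift ord0 j).
have /arvX arv0 : SM c1.
  have Hc' : H c'.
    suff -> : c' = compress S (tuple_add c (@unit_tuple R g m)).
      by apply: cone_compress => //; apply: cone_add => //; apply: cone_unit.
    by apply/funext=> i; rewrite /compress psdS.1.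
  by have [_ symc] := cone_SM coneH Hc'; split=> // j; apply: symc.
have b'0 j : b' (lift ord0 j) = 0.
  apply: (arv0 (fun j => b' (lift ord0 j))); apply/DE.
  suff -> : homogenize (fun i => block_mx (X i) (b' (lift ord0 i))
      (b' (lift ord0 i))^T (c1 i)) = dilation (homogenize X) b' c' by [].
  apply: homogenizeP => [|k]; rewrite /dilation ?homogenize0 ?homogenize_lift //.
  by rewrite /b' /c' b0 mul0mx trmx0 unit_tuple0 SS -scalar_mx_block.
move=> i; apply/eqP; rewrite -subr_eq0 -/(b i).
case: (unliftP ord0 i) => [j|] ->; last by rewrite b0.
by rewrite -[b _](mulmxK uS) -/(b' _) b'0 mul0mx.
Qed.

End Dehomogenize.
End Arveson.

(** * Projective maps *)

Section ProjectiveMaps.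
Context {R : realType}.

(** For invertible Z_0 the pseudoinverse is the inverse, so dehomogenizing is the congruence by
    Z_0^{-1/2}, which turns coordinate 0 into I. *)
Lemma homogenize_dehomogenize g n (Z : mxtuple R g.+1 n) :
  psd (Z ord0) -> Z ord0 \in unitmx ->
  homogenize (dehomogenize Z) = compress (psd_sqrt (invmx (Z ord0))) Z.
Proof.
move=> psdZ uZ; have [psdS _ SZS] := psd_inv_sqrt psdZ uZ.
apply: homogenizeP => [|j]; rewrite /compress psdS.1 //.
by rewrite /dehomogenize moore_penrose_unit.
Qed.

(** Coordinate 0 is S^2; by uniqueness of psd square roots the normalizing factor is exactly S^{-1},
    not merely S^{-1} up to an orthogonal matrix. *)
Lemma dehomogenize_compress g n (S : 'M[R]_n) (X : mxtuple R g n) :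
  psd S -> S \in unitmx -> dehomogenize (compress S (homogenize X)) = X.
Proof.
move=> psdS uS; apply/funext=> j; rewrite /dehomogenize.
have -> : compress S (homogenize X) ord0 = S *m S.
  by rewrite /compress homogenize0 mulmx1 psdS.1.
rewrite moore_penrose_unit ?unitmx_mul ?uS //.
have -> : invmx (S *m S) = invmx S *m invmx S.
  apply: (can_inj (mulKmx uS)); rewrite mulmxA mulmxV // mul1mx.
  apply: (can_inj (mulKmx uS)); rewrite mulmxA !mulmxV ?unitmx_mul ?uS //.
rewrite psd_sqrtE; last exact: psd_invmx.
by rewrite /compress homogenize_lift psdS.1 !mulmxA mulVmx // mul1mx mulmxK.
Qed.

Section HomogeneousSpectrahedron.
Variables (g d : nat) (A : mxtuple R g d).
Hypothesis SMA : SM A.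

Lemma hom_free_spectrahedron_unit :
  hom_free_spectrahedron (homogenize A) 1%N (unit_tuple 1).
Proof.
split; first by apply/SM_homogenize; split=> // i; rewrite trmx0.
rewrite Lpencil_homogenize /Lpencil big1 ?addr0.
  2: by move=> i _; rewrite tensmx0.
exact: psd1.
Qed.

(** The pencil takes the value -I there, and [SM A] provides d > 0, hence a diagonal entry -1. *)
Lemma hom_free_spectrahedron_unitN :
  ~ hom_free_spectrahedron (homogenize A) 1%N (fun i => - unit_tuple 1 i).
Proof.
case=> _; have [d0 _] := SMA.
have -> : \sum_i homogenize A i *t (- unit_tuple 1 i : 'M[R]_1) =
    - \sum_i homogenize A i *t unit_tuple 1 i.
  rewrite -sumrN; apply: eq_bigr => i _.
  by apply/matrixP=> k l; rewrite !mxE mulrN.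
rewrite Lpencil_homogenize /Lpencil big1 ?addr0.
  2: by move=> i _; rewrite tensmx0.
have d1 : (0 < d * 1)%N by rewrite muln1.
move/(psd_diag_ge0 (Ordinal d1)); rewrite !mxE eqxx oppr_ge0.
by rewrite ler10.
Qed.

End HomogeneousSpectrahedron.

Lemma positive_hom_unit g (K : free_set R g.+1) :
  positive_hom_free_spectrahedron K -> K 1%N (unit_tuple 1).
Proof.
case=> _ /interior_subset; rewrite /level1 /=.
suff -> : (fun i => ((delta_mx 0 ord0 : 'rV[R]_g.+1) 0 i)%:M) =
  @unit_tuple R g 1 by [].
apply/esym/homogenizeP => [|j]; first by rewrite mxE !eqxx.
by rewrite mxE eqxx -scalemx1 scale0r.
Qed.

(** * Comparison of the slices of a cone and of its image under an invertible [W] *)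

Section Transport.
Variables (g : nat) (W : 'M[R]_g.+1) (H : free_set R g.+1).
Let K := Timage W H.
Hypotheses (uW : W \in unitmx).
Hypotheses (coneH : matrix_cone H) (H1 : H (unit_tuple 1))
  (bndH : bounded_free_set (dehomogenize_set H))
  (HN1 : ~ H (fun i => - unit_tuple 1 i)).
Hypotheses (coneK : matrix_cone K) (K1 : K (unit_tuple 1))
  (bndK : bounded_free_set (dehomogenize_set K)).

(** Otherwise z = W^{-1}(1, 0, ..., 0) and -z both lie in H, and the level 1 bound for both signs
    forces z = 0, against the invertibility of [W]. *)
Lemma Timage_unitN : ~ K (fun i => - unit_tuple 1 i).
Proof.
move=> /(TimageE _ _ uW) HN; have /(TimageE _ _ uW) HP := K1.
have [c c0 bound] := level1_bound coneH H1 bndH HN1.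
pose Z := Tmap (invmx W) (@unit_tuple R g 1).
have NZ : Tmap (invmx W) (fun i => - @unit_tuple R g 1 i) = fun i => - Z i.
  apply/funext=> i; rewrite /Tmap /Z /Tmap -sumrN.
  by apply: eq_bigr => j _; rewrite scalerN.
have Z0 i : Z i 0 0 = 0.
  have := bound _ HP i; have := bound _ HN i; rewrite NZ -/Z !mxE normrN.
  by rewrite mulrN => ? ?; apply/eqP; rewrite -normr_le0; lra.
have : Tmap W Z ord0 0 0 = 0.
  by rewrite /Tmap summxE big1 // => j _; rewrite mxE Z0 mulr0.
by rewrite TmapKV // unit_tuple0 mxE => /eqP; rewrite oner_eq0.
Qed.

(* Boundedness of the image makes ker Z_0 the joint kernel of the Z_i, and the
   joint kernel of T_W (I, X) is that of (I, X), which is 0. *)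
Lemma Tmap_homogenize_unitmx n (X : mxtuple R g n) :
  H (homogenize X) -> Tmap W (homogenize X) ord0 \in unitmx.
Proof.
move=> HX.
apply: (cone_unitmx coneK K1 bndK Timage_unitN (Timage_Tmap W HX)) => v Zv.
rewrite -[v]mul1mx -(homogenize0 X) -(TmapK (homogenize X) uW).
rewrite [Tmap (invmx W)]lock /Tmap -lock mulmx_suml big1 // => j _.
by rewrite -scalemxAl Zv scaler0.
Qed.

Lemma homogenize_Pmap n (X : mxtuple R g n) : H (homogenize X) ->
  exists2 S : 'M[R]_n, S \in unitmx &
    homogenize (Pmap W X) = compress S (Tmap W (homogenize X)).
Proof.
move=> HX; have uZ := Tmap_homogenize_unitmx HX.
have psdZ := cone_psd0 coneK K1 bndK Timage_unitN (Timage_Tmap W HX).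
exists (psd_sqrt (invmx (Tmap W (homogenize X) ord0))).
  by have [] := psd_inv_sqrt psdZ uZ.
exact: homogenize_dehomogenize.
Qed.

(** The homogeneous property is carried from (I, X) to (I, P_W(X)) by [W] and then by the congruence
    [S], and back by their inverses in the opposite order. *)
Lemma arveson_boundary_Pmap n (X : mxtuple R g n) :
  H (homogenize X) ->
  arveson_boundary (dehomogenize_set H) n X <->
  arveson_boundary (dehomogenize_set K) n (Pmap W X).
Proof.
move=> HX; have [S uS hP] := homogenize_Pmap HX.
have n0 := (cone_SM coneH HX).1.
split=> /arveson_boundary_dehomogenize.
  case/(_ coneH H1 bndH HN1) => _ arvX.
  apply/(arveson_boundary_dehomogenize coneK K1 bndK Timage_unitN); rewrite hP.
  split; first by apply: cone_compress => //; exact: Timage_Tmap.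
  by apply: hom_arveson_compress => //; exact: hom_arveson_Timage.
case/(_ coneK K1 bndK Timage_unitN) => _ arvP.
apply/(arveson_boundary_dehomogenize coneH H1 bndH HN1); split=> //.
have uS' : invmx S \in unitmx by rewrite unitmx_inv.
have := hom_arveson_compress coneK uS' arvP.
rewrite hP compressM mulmxV // compress1 => arvZ.
have uW' : invmx W \in unitmx by rewrite unitmx_inv.
by have := hom_arveson_Timage uW' arvZ; rewrite TimageK // TmapK.
Qed.

End Transport.

(** The preimage is the dehomogenization of Q = T_{W^{-1}}(I, Y). Boundedness of the slice of H,
    instead of that of its image, now makes Q_0 invertible; as T_W commutes with congruences, the
    normalization of Q is undone at the end. *)
Lemma Pmap_surjective g (W : 'M[R]_g.+1) (H : free_set R g.+1) n
    (Y : mxtuple R g n) :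
  W \in unitmx ->
  matrix_cone H -> H 1%N (unit_tuple 1) ->
  bounded_free_set (dehomogenize_set H) ->
  ~ H 1%N (fun i => - unit_tuple 1 i) ->
  Timage W H n (homogenize Y) ->
  exists2 X, H n (homogenize X) & Pmap W X = Y.
Proof.
move=> uW coneH H1 bndH HN1 /(TimageE _ _ uW); set Q := Tmap _ _ => HQ.
have n0 := (cone_SM coneH HQ).1.
have psdQ := cone_psd0 coneH H1 bndH HN1 HQ.
have uQ : Q ord0 \in unitmx.
  apply: (cone_unitmx coneH H1 bndH HN1 HQ) => v Qv.
  rewrite -[v]mul1mx -(homogenize0 Y) -(TmapKV (homogenize Y) uW) -/Q.
  by rewrite /Tmap mulmx_suml big1 // => j _; rewrite -scalemxAl Qv scaler0.
have [psdS uS _] := psd_inv_sqrt psdQ uQ.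
have hX := homogenize_dehomogenize psdQ uQ.
exists (dehomogenize Q); first by rewrite hX; exact: cone_compress.
by rewrite /Pmap hX Tmap_compress /Q TmapKV // dehomogenize_compress.
Qed.

End ProjectiveMaps.

Theorem theorem3p6 (R : realType) (g d : nat) (A : mxtuple R g d) (hA : SM A)
  (W : 'M[R]_g.+1)
  (H : free_set R g.+1) (hH : is_homogenization (free_spectrahedron A) H)
  (hproj : projective_transformation W H) (hinv : W \in unitmx)
  (hbdd : bounded_free_spectrahedron (free_spectrahedron A))
  (hbddP : bounded_free_spectrahedron (projective_image W H)) :
  (forall (n : nat) (X : mxtuple R g n), free_spectrahedron A n X ->
     (arveson_boundary (free_spectrahedron A) n X <->
      arveson_boundary (projective_image W H) n (Pmap W X)))
  /\
  (arveson_boundary (projective_image W H) =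
     fun n => Pmap W @` arveson_boundary (free_spectrahedron A) n).
Proof.
(* The tuple [A'] behind the homogenization may differ from [A], even in size; both define the same
   free spectrahedron, which is the slice of [H]. *)
have [d' [A' [[SMA' DA' _] HE]]] := hH.
have DE : free_spectrahedron A = dehomogenize_set H.
  by rewrite -DA' HE free_spectrahedron_dehomogenize.
have coneH : matrix_cone H by rewrite HE; exact: hom_free_spectrahedron_cone.
have H1 : H 1%N (unit_tuple 1) by rewrite HE; exact: hom_free_spectrahedron_unit.
have HN1 : ~ H 1%N (fun i => - unit_tuple 1 i).
  by rewrite HE; exact: hom_free_spectrahedron_unitN.
have bndH : bounded_free_set (dehomogenize_set H) by rewrite -DE; exact: hbdd.2.
have coneK : matrix_cone (Timage W H).
  by have [[e [B [_ ->]]] _] := hproj; exact: hom_free_spectrahedron_cone.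
have K1 := positive_hom_unit hproj.
have arvP n (X : mxtuple R g n) : dehomogenize_set H n X ->
    arveson_boundary (dehomogenize_set H) n X <->
    arveson_boundary (projective_image W H) n (Pmap W X).
  by case=> _ HX; apply: arveson_boundary_Pmap => //; exact: hbddP.2.
rewrite DE; split; first exact: arvP.
apply: functional_extensionality_dep => n.
(* The equality of sets follows from the pointwise equivalence, once every boundary point [Y] is
   known to be of the form [Pmap W X]. *)
apply/seteqP; split=> [Y arvY|_ [X arvX <-]].
  have [X HX PX] := Pmap_surjective hinv coneH H1 bndH HN1 arvY.1.2.
  exists X => //; apply/arvP; last by rewrite PX.
  by split=> //; apply/SM_homogenize/(cone_SM coneH).
by apply/arvP => //; exact: arvX.1.
Qed.
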